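(* Let $G$ be a connected unicyclic graph of order $n \ge 6$ whose complement $\overline{G}$ is connected. Then $Z(G)=n-3$ if and only if $G$ is the vertex sum of $C_3$ and the star $S_{n-2}$ at one of the leaves of the star, i.e., $G$ is obtained from a triangle $C_3$ and a star $S_{n-2}=K_{1,n-3}$ by identifying one vertex of the triangle with one leaf of the star.
   Context: A connected graph is unicyclic if it contains exactly one cycle. For a finite simple graph $G$, color a set $S\subseteq V(G)$ black and all other vertices white. The color-change rule: if a black vertex $u$ has exactly one white neighbor $w$, then $w$ is turned black. $S$ is a zero forcing set if repeated application of the rule eventually turns all vertices black; $Z(G)$ is the minimum size of a zero forcing set. $\overline{G}$ is the complement of $G$. $S_{n-2}=K_{1,n-3}$ is the star on $n-2$ vertices. *)

(* Defs.v *)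
From mathcomp Require Import all_boot.

Set Implicit Arguments.
Unset Strict Implicit.
Unset Printing Implicit Defensive.

Record sgraph := SGraph {
  vertex :> finType;
  adj : rel vertex;
  adj_sym : symmetric adj;
  adj_irr : irreflexive adj }.

Definition graph_iso (G H : sgraph) : Prop :=
  exists2 f : G -> H, bijective f & forall x y, adj (f x) (f y) = adj x y.

Section Basics.
Variable G : sgraph.
Implicit Types (x y u w : G) (S : {set G}).

Definition neighbors x : {set G} := [set y | adj x y].

Definition connected : Prop := forall x y, connect (@adj G) x y.

Definition compl_adj : rel G := [rel x y | (x != y) && ~~ adj x y].

Fact compl_adj_sym : symmetric compl_adj.
Proof. by move=> x y; rewrite /compl_adj /= eq_sym adj_sym. Qed.

Fact compl_adj_irr : irreflexive compl_adj.
Proof. by move=> x; apply/negP; case/andP; rewrite eqxx. Qed.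

Definition compl : sgraph := SGraph compl_adj_sym compl_adj_irr.

(* A cycle is a subgraph, identified with its edge set: the cyclic sequence c *)
(* traversing it is only determined up to starting point and direction, while *)
(* the vertex set alone would not distinguish all cycles.                     *)
Definition is_cycle (C : {set {set G}}) : Prop :=
  exists c : seq G, [/\ 2 < size c, ucycle (@adj G) c
                      & C = [set [set x; next c x] | x in c]].

Definition unicyclic : Prop := connected /\ exists! C, is_cycle C.

Definition color_change : rel {set G} := [rel S S' : {set G} |
  [exists u in S, exists w,
     (neighbors u :\: S == [set w]) && (S' == w |: S)]].

Definition zero_forcing S : bool := connect color_change S [set: G].

Fact zero_forcing_setT : zero_forcing [set: G].
Proof. exact: connect0. Qed.

Definition zero_forcing_number : nat :=
  #|[arg min_(S < [set: G] | zero_forcing S) #|S|]|.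

Fact zero_forcing_number_attained :
  exists2 S, zero_forcing S & #|S| = zero_forcing_number.
Proof.
rewrite /zero_forcing_number.
by case: arg_minnP => [|S fS _]; [exact: zero_forcing_setT | exists S].
Qed.

Fact zero_forcing_number_min S : zero_forcing S -> zero_forcing_number <= #|S|.
Proof.
rewrite /zero_forcing_number => fS.
by case: arg_minnP => [|S0 _]; [exact: zero_forcing_setT | exact].
Qed.

Definition leaf x : bool := #|neighbors x| == 1.

End Basics.

Section CycleGraph.
Variable k : nat.

(* The conjunct x != y only matters for k = 1. *)
Definition cycle_adj : rel 'I_k :=
  [rel x y | (x != y) && ((ordS x == y) || (ordS y == x))].

Fact cycle_adj_sym : symmetric cycle_adj.
Proof. by move=> x y; rewrite /cycle_adj /= eq_sym orbC. Qed.

Fact cycle_adj_irr : irreflexive cycle_adj.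
Proof. by move=> x; apply/negP; case/andP; rewrite eqxx. Qed.

Definition cycle_graph : sgraph := SGraph cycle_adj_sym cycle_adj_irr.

End CycleGraph.

Section CompleteBipartite.
Variables p q : nat.

Definition biclique_adj : rel ('I_p + 'I_q) := [rel x y |
  match x, y with inl _, inr _ | inr _, inl _ => true | _, _ => false end].

Fact biclique_adj_sym : symmetric biclique_adj.
Proof. by case=> x [y|y]. Qed.

Fact biclique_adj_irr : irreflexive biclique_adj.
Proof. by case. Qed.

Definition biclique : sgraph := SGraph biclique_adj_sym biclique_adj_irr.

End CompleteBipartite.

(* The star on m vertices (m > 0). *)
Definition star (m : nat) : sgraph := biclique 1 m.-1.

Section VertexSum.
Variables (G H : sgraph) (u : G) (v : H).

(* The disjoint union of G and H with v identified with u: the merged vertex *)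
(* is represented by u, and inherits the neighbors of v in H.                *)
Definition vertex_sum_adj : rel (G + {y : H | y != v}) := [rel a b |
  match a, b with
  | inl x, inl x' => adj x x'
  | inr y, inr y' => adj (val y) (val y')
  | inl x, inr y | inr y, inl x => (x == u) && adj v (val y)
  end].

Fact vertex_sum_adj_sym : symmetric vertex_sum_adj.
Proof. by move=> [x|x] [y|y]; rewrite /vertex_sum_adj /= 1?adj_sym. Qed.

Fact vertex_sum_adj_irr : irreflexive vertex_sum_adj.
Proof. by case=> x; apply: adj_irr. Qed.

Definition vertex_sum : sgraph := SGraph vertex_sum_adj_sym vertex_sum_adj_irr.

End VertexSum.

(* Main.v *)
(* A run of k forces u_i -> w_i with u_i adjacent to w_i, and neither equal nor
   adjacent to any later w_j, shows Z(G) <= n - k.  If Z(G) = n - 3 there is no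
   such run with k = 4; in particular there is no induced path on five vertices.
   In a unicyclic graph a path is induced as soon as it misses a vertex of the
   cycle, so the cycle has length at most 4 and the rest of the graph stays close
   to it.  Explicit runs exclude length 4.  For a triangle, a vertex at distance 2
   forces the claimed shape, and if every vertex is attached to the triangle,
   connectedness of the complement leaves at most one vertex at each corner, that
   is the net, which again has a run of four forces.  The lower bound
   Z >= n - 3 for the claimed graph comes from forts: two leaves of the star, the
   two free triangle vertices a and b, and {t, a, l} and {t, b, l} with t the
   merged vertex and l a leaf. *)
Require Import Defs.
From mathcomp Require Import all_boot.

Set Implicit Arguments.
Unset Strict Implicit.
Unset Printing Implicit Defensive.

Lemma card_notin (T : finType) (s : seq T) :
  #|T| - size s <= #|[pred z | z \notin s]|.
Proof. by rewrite leq_subLR -(cardC (mem s)) leq_add2r card_size. Qed.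

(** * Zero forcing: runs of forces, forts, and consequences of connectedness and of a unique
    cycle *)

Section ZeroForcing.
Variable G : sgraph.
Implicit Types (x y u w : G) (S F : {set G}).

(** A pair [(u, w)] stands for the force u -> w, in order of execution. Initially the white vertices
    are exactly the second components, so the condition on later pairs says that u is already black
    and that w is its only white neighbor. *)
Fixpoint forcing_chain (s : seq (G * G)) : bool :=
  if s is (u, w) :: s' then
    [&& adj u w, all (fun p => (u != p.2) && ~~ adj u p.2) s'
      & forcing_chain s']
  else true.

Lemma forcing_chain_uniq (s : seq (G * G)) :
  forcing_chain s -> uniq [seq p.2 | p <- s].
Proof.
elim: s => //= -[u w] s IH /and3P[uw /allP us /IH ->]; rewrite andbT.
by apply/mapP=> -[p /us /andP[_ /negP up] /= E]; apply: up; rewrite -E.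
Qed.

(** Performing the first force leaves white exactly the targets of the tail, so induction
    applies. *)
Lemma forcing_chain_zero_forcing (s : seq (G * G)) :
  forcing_chain s -> zero_forcing (~: [set w in [seq p.2 | p <- s]]).
Proof.
elim: s => [_|[u w] s IH chain_s].
  rewrite /zero_forcing (_ : ~: _ = setT) ?connect0 //.
  by apply/setP=> x; rewrite !inE.
have := forcing_chain_uniq chain_s; case/andP=> /= w_notin _.
case/and3P: chain_s => uw /allP us /IH; apply: connect_trans.
apply: connect1; apply/existsP; exists u; apply/andP; split.
  rewrite !inE negb_or; apply/andP; split.
    by apply/eqP=> E; rewrite -E adj_irr in uw.
  by apply/mapP=> -[p /us /andP[/negP up _] /= E]; apply: up; rewrite -E.
apply/existsP; exists w; apply/andP; split; apply/eqP/setP=> x; rewrite !inE.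
  have [-> //|xw] := eqVneq x w; rewrite /= negbK.
  by apply/negP=> /andP[/mapP[p /us /andP[_ /negP up] ->]].
by have [->|] := eqVneq x w.
Qed.

Lemma zero_forcing_number_chain (s : seq (G * G)) :
  forcing_chain s -> zero_forcing_number G <= #|G| - size s.
Proof.
move=> chain_s.
apply: leq_trans (zero_forcing_number_min (forcing_chain_zero_forcing chain_s)) _.
rewrite cardsCs setCK leq_sub2l // cardsE.
by have /card_uniqP -> := forcing_chain_uniq chain_s; rewrite size_map.
Qed.

(** No vertex outside F has exactly one neighbor in F. The empty set is allowed. *)
Definition fort F := forall u w, u \notin F -> w \in F -> adj u w ->
  exists2 w', w' \in F & adj u w' && (w' != w).

(** A fully white fort stays white: a black vertex with a neighbor in F has a second one there, also
    white, so it cannot force into F. As everything ends up black, F is empty. *)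
Lemma zero_forcing_fort S F :
  zero_forcing S -> fort F -> [disjoint S & F] -> F = set0.
Proof.
move=> /connectP[p]; elim: p S => [|S' p IH] S /=.
  by move=> _ <- _; rewrite -setI_eq0 setTI => /eqP.
case/andP=> /existsP[u /andP[uS /existsP[w /andP[/eqP Nu /eqP ->]]]].
move=> pathS' lastS' fortF dSF; apply: (IH _ pathS' lastS' fortF).
rewrite -setI_eq0 setIUl setU_eq0 !setI_eq0 disjoints1 dSF andbT; apply/negP=> wF.
have /setDP[+ _] : w \in neighbors u :\: S by rewrite Nu set11.
rewrite inE => uw.
have [w' w'F /andP[uw' /negP[]]] := fortF u w (negbT (disjointFr dSF uS)) wF uw.
by rewrite -in_set1 -Nu !inE uw' (disjointFl dSF).
Qed.

Lemma connected_edge_boundary S x y :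
  connected G -> x \in S -> y \notin S ->
  exists2 u, u \in S & exists2 w, w \notin S & adj u w.
Proof.
move=> conG xS yS; have /connectP[p] := conG x y.
elim: p x xS => [|z p IH] x xS /=; first by move=> _ E; rewrite E xS in yS.
have [zS|zS] := boolP (z \in S); first by case/andP=> _; apply: IH.
by case/andP=> xz _ _; exists x => //; exists z.
Qed.

Lemma co_connected_non_neighbor x :
  1 < #|G| -> connected (compl G) -> exists2 y, y != x & ~~ adj x y.
Proof.
move=> G1 conG.
have /card_gt0P[z] : 0 < #|[set~ x]|.
  by rewrite cardsCs setCK cards1 subn_gt0.
rewrite !inE => zx; have /connectP[[|y p] /=] := conG x z.
  by move=> _ E; rewrite E eqxx in zx.
by case/andP=> /andP[xy nxy] _ _; exists y; rewrite // eq_sym.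
Qed.

(** This is the form in which uniqueness of the cycle is used: cycles with the same edge set have
    the same vertices, so those of the unique cycle lie on every cycle. *)
Lemma unicyclic_mem : unicyclic G ->
  exists2 c : seq G, (2 < size c) && cycle (@adj G) c && uniq c &
    forall d, 2 < size d -> cycle (@adj G) d -> uniq d -> {subset c <= d}.
Proof.
case=> _ [C [[c [c2 /andP[cc cu] defC]] uniqC]].
exists c => [|d d2 cd du x xc]; first by rewrite c2 cc.
have E : C = [set [set y; next d y] | y in d].
  by apply: uniqC; exists d; split=> //; apply/andP.
have : [set x; next c x] \in C by rewrite defC; apply/imsetP; exists x.
rewrite E => /imsetP[y yd] /setP/(_ x); rewrite !inE eqxx /=.
by move/esym/orP=> [] /eqP ->; rewrite ?mem_next.
Qed.

End ZeroForcing.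

(** * The extremal graph: description by four marked vertices, and its zero forcing number *)

Section TriangleStar.

Section Shape.
Variable T : eqType.
Variables t a b c : T.

(** Each edge in one orientation; [shape] symmetrizes. The last disjunct makes every unmarked vertex
    a leaf at c, so the four marked vertices determine the whole graph. *)
Definition half_shape x y : bool :=
  [|| (x == t) && (y \in [:: a; b; c]), (x == a) && (y == b)
    | (x == c) && (y \notin [:: t; a; b; c])].

Definition shape x y := half_shape x y || half_shape y x.
End Shape.

(* t is the merged vertex, a and b the rest of the triangle, c the centre of the
   star. *)
Definition triangle_star (G : sgraph) (t a b c : G) :=
  uniq [:: t; a; b; c] /\ forall x y, adj x y = shape t a b c x y.

Lemma shape_inj (T T' : eqType) (f : T -> T') t a b c x y : injective f ->
  shape (f t) (f a) (f b) (f c) (f x) (f y) = shape t a b c x y.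
Proof. by move=> fI; rewrite /shape /half_shape !inE !(inj_eq fI). Qed.

(** Both lists are completed to enumerations of their types, and entries are matched by position. *)
Lemma bijection_extending (T T' : finType) (x0 : T') (s : seq T) (s' : seq T') :
  #|T| = #|T'| -> size s = size s' -> uniq s -> uniq s' ->
  exists2 f : T -> T', bijective f & map f s = s'.
Proof.
move=> cardE sizeE us us'.
pose compl (X : finType) (q : seq X) := q ++ [seq x <- enum X | x \notin q].
have compl_uniq (X : finType) (q : seq X) : uniq q -> uniq (compl X q).
  move=> uq; rewrite cat_uniq uq filter_uniq ?enum_uniq // andbT /=.
  by apply/hasPn=> x; rewrite mem_filter => /andP[].
have mem_compl (X : finType) (q : seq X) x : x \in compl X q.
  by rewrite mem_cat mem_filter mem_enum andbT orbN.
have size_compl (X : finType) (q : seq X) : uniq q -> size (compl X q) = #|X|.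
  move=> uq; rewrite -(card_uniqP (compl_uniq X q uq)).
  by apply: eq_card => x; rewrite mem_compl.
exists (fun x => nth x0 (compl T' s') (index x (compl T s))).
  apply: inj_card_bij; last by rewrite cardE.
  move=> x y /eqP; rewrite nth_uniq ?compl_uniq ?size_compl -?cardE //.
  - by move/eqP/(congr1 (nth x (compl T s))); rewrite !nth_index.
  - by rewrite -(size_compl T s us) index_mem.
  - by rewrite -(size_compl T s us) index_mem.
apply: (@eq_from_nth _ x0); rewrite size_map // => i lt_is.
have [x0' _] : exists x : T, true by case: s lt_is {us sizeE} => // x; exists x.
rewrite (nth_map x0') // index_cat mem_nth // index_uniq // nth_cat.
by rewrite -sizeE lt_is.
Qed.

(** Adjacency depends only on equality with the marked vertices, so any bijection matching these is
    an isomorphism. *)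
Lemma triangle_star_iso (G H : sgraph) (t a b c : G) (t' a' b' c' : H) :
  #|G| = #|H| -> triangle_star t a b c -> triangle_star t' a' b' c' ->
  graph_iso G H.
Proof.
move=> cardE [u adjG] [u' adjH].
have [f f_bij [ft fa fb fc]] :=
  @bijection_extending _ _ t' [:: t; a; b; c] [:: t'; a'; b'; c'] cardE erefl u u'.
exists f => // x y; rewrite adjH adjG -ft -fa -fb -fc shape_inj //.
exact: bij_inj.
Qed.

Lemma graph_iso_triangle_star (G H : sgraph) (t a b c : H) :
  graph_iso G H -> triangle_star t a b c ->
  exists (t' a' b' c' : G), triangle_star t' a' b' c'.
Proof.
move=> [f [g gK fK] adjf] [u adjH].
exists (g t), (g a), (g b), (g c); split=> [|x y].
  by rewrite -[X in uniq X]/(map g [:: t; a; b; c]) map_inj_uniq //; apply: can_inj fK.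
by rewrite -adjf adjH -(gK x) -(gK y) shape_inj ?gK //; apply: can_inj fK.
Qed.

Lemma vertex_sum_triangle_star (m : nat) (t : cycle_graph 3)
    (l : star m.+3) : leaf l ->
  exists t' a' b' c' : vertex_sum t l, triangle_star t' a' b' c'.
Proof.
(* The star has at least three vertices, so its centre has two neighbors and cannot be the leaf
   [l]. *)
case: l => [i|i] leaf_l.
  have /cards1P[x Nx] := leaf_l.
  have all_eq (j : 'I_m.+2) : inr j = x.
    by apply/set1P; rewrite -Nx inE.
  by have := all_eq ord0; rewrite -(all_eq ord_max) => -[].
have cE : (inl ord0 : star m.+3) != inr i by [].
exists (inl t), (inl (ordS t)), (inl (ordS (ordS t))).
exists (inr (exist (fun y : star m.+3 => y != inr i) (inl ord0) cE)).
have [t1 t2 t3] : [/\ t != ordS t, t != ordS (ordS t) & ordS t != ordS (ordS t)].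
  by case: t => [[|[|[|]]]].
have tT (x : 'I_3) : [|| x == t, x == ordS t | x == ordS (ordS t)].
  by move: t x {t1 t2 t3 leaf_l} => [[|[|[|]]]//=?] [[|[|[|]]]].
pose V := vertex_sum t (inr i : star m.+3).
have E1 (x y : 'I_3) : (inl x == inl y :> V) = (x == y) by [].
have E2 (x : 'I_3) y : (inl x == inr y :> V) = false by [].
have E3 (x : 'I_3) y : (inr y == inl x :> V) = false by [].
(* Among the remaining star vertices, the centre is the only neighbor of the leaf, so being the
   centre amounts to adjacency to it. *)
have E4 (y : {y : star m.+3 | y != inr i}) :
    (inr y == inr (exist (fun y : star m.+3 => y != inr i) (inl ord0) cE)
      :> V) = adj (val y) (inr i : star m.+3).
  by case: y => -[y|y] ? //=; rewrite (ord1 y).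
split=> [|[x|x] [y|y]]; last first.
all: rewrite /shape /half_shape ?inE ?(E1, E2, E3, E4) ?andbF ?andbT ?orbF /=.
- by case: x y => [[x|x] ?] [[y|y] ?].
- by rewrite tT andbF; case: x => [[x|x] ?].
- by rewrite tT andbF orbF; case: y => [[y|y] ?].
- move: t x y {t1 t2 t3 tT leaf_l E1 E2 E3 E4 V}.
  by move=> [[|[|[|]]]//=?] [[|[|[|]]]//=?] [[|[|[|]]]].
by rewrite !inE !(E1, E2) !orbF negb_or; apply/and3P; split=> //; apply/andP.
Qed.

Lemma triangle_star_intro (G : sgraph) (t a b c : G) :
  uniq [:: t; a; b; c] ->
  [&& adj t a, adj t b, adj a b, adj t c, ~~ adj a c & ~~ adj b c] ->
  (forall x, x \notin [:: t; a; b; c] ->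
     [&& adj c x, ~~ adj t x, ~~ adj a x & ~~ adj b x]) ->
  (forall x y, x \notin [:: t; a; b; c] -> y \notin [:: t; a; b; c] ->
     ~~ adj x y) ->
  triangle_star t a b c.
Proof.
move=> u adjs ctr leaves; split=> // x y.
pose s := [:: t; a; b; c].
(* By symmetry of both sides, it is enough to compare pairs whose first vertex is marked; pairs of
   unmarked vertices are non-edges. *)
have half v w : v \in s -> adj v w = shape t a b c v w.
  have ww := adj_irr w.
  case/and3P: u adjs; rewrite !inE !negb_or => /and3P[ta tb tc] /andP[ab ac].
  rewrite !andbT => bc /andP[eta /and5P[etb eab etc /negbTE eac /negbTE ebc]].
  have rev (p q : G) : p != q -> (q == p) = false by rewrite eq_sym => /negbTE.
  have [ws|ws] := boolP (w \in s); last first.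
    have := ctr w ws; move: ws; rewrite !inE !negb_or.
    case/and4P=> /negbTE wt /negbTE wa /negbTE wb /negbTE wc.
    case/and4P=> e1 /negbTE e2 /negbTE e3 /negbTE e4.
    by case/or4P=> /eqP ->; rewrite /shape /half_shape !inE ?e1 ?e2 ?e3 ?e4
      wt wa wb wc ?eqxx ?(negbTE ta) ?(negbTE tb) ?(negbTE tc) ?(negbTE ab)
      ?(negbTE ac) ?(negbTE bc) ?(rev _ _ ta) ?(rev _ _ tb) ?(rev _ _ tc)
      ?(rev _ _ ab) ?(rev _ _ ac) ?(rev _ _ bc).
  move: ws; rewrite !inE.
  by case/or4P=> /eqP E; case/or4P=> /eqP ->; rewrite ?ww E;
    rewrite /shape /half_shape !inE;
    rewrite ?adj_irr ?eta ?etb ?eab ?etc ?eac ?ebc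
      ?(adj_sym a t) ?(adj_sym b t) ?(adj_sym b a) ?(adj_sym c t)
      ?(adj_sym c a) ?(adj_sym c b) ?eta ?etb ?eab ?etc ?eac ?ebc
      ?eqxx ?(negbTE ta) ?(negbTE tb) ?(negbTE tc) ?(negbTE ab)
      ?(negbTE ac) ?(negbTE bc) ?(rev _ _ ta) ?(rev _ _ tb) ?(rev _ _ tc)
      ?(rev _ _ ab) ?(rev _ _ ac) ?(rev _ _ bc).
have [/half //|xs] := boolP (x \in s).
have [/half E|ys] := boolP (y \in s); first by rewrite adj_sym E /shape orbC.
rewrite (negbTE (leaves x y xs ys)).
by move: xs ys; rewrite /shape /half_shape !inE !negb_or
  => /and4P[/negbTE-> /negbTE-> _ /negbTE->] /and4P[/negbTE-> /negbTE-> _ /negbTE->].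
Qed.

Lemma triangle_star_zero_forcing_number (G : sgraph) (t a b c : G) :
  5 <= #|G| -> triangle_star t a b c -> zero_forcing_number G = #|G| - 3.
Proof.
move=> n5 [uniq_s adjG]; pose s := [:: t; a; b; c].
have := uniq_s; rewrite /= !inE !negb_or !andbT.
case/and3P=> /and3P[ta tb tc] /andP[ab ac] bc.
have rev (p q : G) : p != q -> (q == p) = false by rewrite eq_sym => /negbTE.
pose neqs := (negbTE ta, negbTE tb, negbTE tc, negbTE ab, negbTE ac, negbTE bc,
  rev _ _ ta, rev _ _ tb, rev _ _ tc, rev _ _ ab, rev _ _ ac, rev _ _ bc).
have adj_t u : adj u t = (u \in [:: a; b; c]).
  by rewrite adjG /shape /half_shape !inE !neqs !eqxx /= !(andbF, andbT, orbF).
have adj_a u : adj u a = (u \in [:: t; b]).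
  by rewrite adjG /shape /half_shape !inE !neqs !eqxx /= !(andbF, andbT, orbF).
have adj_b u : adj u b = (u \in [:: t; a]).
  by rewrite adjG /shape /half_shape !inE !neqs !eqxx /= !(andbF, andbT, orbF).
have adj_leaf l u : l \notin s -> adj u l = (u == c).
  rewrite adjG /shape /half_shape !inE !negb_or.
  case/and4P=> /negbTE-> /negbTE-> /negbTE-> /negbTE->.
  by rewrite !(andbF, andbT, orbF).
apply/eqP; rewrite eqn_leq; apply/andP; split.
  have /card_gt0P[l ls] : 0 < #|[pred z | z \notin s]|.
    by apply: leq_trans (card_notin s); rewrite subn_gt0.
  have := ls; rewrite !inE !negb_or => /and4P[lt la lb lc].
  (* With t, c and one leaf l white, a forces t, then t forces c, then c forces l. *)
  have := @zero_forcing_number_chain G [:: (a, t); (t, c); (c, l)]; apply.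
  rewrite /= !(adj_leaf l) // adj_t (adj_sym a c) adj_a (adj_sym t c) adj_t.
  by rewrite !inE !neqs !eqxx !(eq_sym _ l) lt la.
have [S zfS <-] := zero_forcing_number_attained G.
(* The lower bound now reads: at most three vertices are white. *)
rewrite leq_subLR -(cardsC S) addnC leq_add2r.
have no_fort (F : {set G}) x : x \in F -> fort F -> F \subset ~: S -> False.
  move=> xF fortF; rewrite subsets_disjoint setCK disjoint_sym => dSF.
  by move: xF; rewrite (zero_forcing_fort zfS fortF dSF) inE.
(* Two vertices with the same neighbors outside the pair form a fort, so they are not both white. *)
have twins x y : x != y -> (forall u, u \notin [:: x; y] -> adj u x = adj u y) ->
    x \notin S -> y \notin S -> False.
  move=> xy adjxy xS yS; apply: (@no_fort [set x; y] x); first by rewrite !inE eqxx.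
    move=> u w; rewrite !inE => uxy /orP[] /eqP-> uw.
      by exists y; rewrite ?inE ?eqxx ?orbT // -adjxy ?inE // uw eq_sym.
    by exists x; rewrite ?inE ?eqxx // adjxy ?inE // uw.
  by apply/subsetP=> z; rewrite !inE => /orP[] /eqP->.
(* The set {t, p, l} is a fort: q sees both t and p, and c sees both t and l. *)
have fort3 p q l : (forall u, adj u t = (u \in [:: p; q; c])) ->
    (forall u, adj u p = (u \in [:: t; q])) -> t != p -> l \notin s ->
    l != p -> t \notin S -> p \notin S -> l \notin S -> False.
  move=> adjt adjp tp ls lp tS pS lS.
  have lt : l != t by move: ls; rewrite !inE !negb_or => /andP[].
  apply: (@no_fort [set t; p; l] t); first by rewrite !inE eqxx.
    move=> u w; rewrite !inE !negb_or -andbA => /and3P[ut up ul] /orP[/orP[]|] /eqP->.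
    - rewrite adjt !inE (negbTE up) /= => /orP[] /eqP->.
        by exists p; rewrite ?adjp ?inE ?eqxx ?orbT // eq_sym.
      by exists l; rewrite ?(adj_leaf l _ ls) ?inE ?eqxx ?orbT.
    - rewrite adjp !inE (negbTE ut) /= => /eqP->.
      by exists t; rewrite ?adjt ?inE ?eqxx ?orbT.
    - rewrite adj_leaf // => /eqP->.
      by exists t; rewrite ?adjt ?inE ?eqxx ?orbT // eq_sym.
  by apply/subsetP=> z; rewrite !inE => /orP[/orP[]|] /eqP->.
have card_le3 x y z : ~: S \subset [:: x; y; z] -> #|~: S| <= 3.
  by move=> sub; apply: leq_trans (subset_leq_card sub) (card_size _).
(* Leaves are twins, so at most one leaf l is white. With q black, the white vertices lie in {t, p,
   c, l}, and [fort3] removes t or p. *)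
have bound p q : (forall u, adj u t = (u \in [:: p; q; c])) ->
    (forall u, adj u p = (u \in [:: t; q])) -> t != p -> s =i [:: t; p; q; c] ->
    q \in S -> #|~: S| <= 3.
  move=> adjt adjp tp sE qS.
  have inS z : z \in ~: S -> z \in s -> z \in [:: t; p; c].
    rewrite inE => zS; rewrite sE !inE.
    by case/or4P=> /eqP E; rewrite E ?eqxx ?orbT // -?E; rewrite E qS in zS.
  have [l /andP[lS ls]|none] := pickP [pred z | (z \notin S) && (z \notin s)]; last first.
    apply: (@card_le3 t p c); apply/subsetP=> z zS; apply: inS => //.
    by have := none z; rewrite /= -in_setC zS => /negbFE.
  have lp : l != p by move: ls; rewrite sE !inE !negb_or => /and4P[].
  have cover z : z \in ~: S -> z \in [:: t; p; c; l].
    move=> zS; have [zs|zs] := boolP (z \in s).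
      by have := inS z zS zs; rewrite !inE => /or3P[] ->; rewrite ?orbT.
    have [->|zl] := eqVneq z l; first by rewrite !inE eqxx !orbT.
    case: (twins z l zl) => // [u _|]; first by rewrite !adj_leaf.
    by rewrite -in_setC.
  have [tS|tS] := boolP (t \in S).
    apply: (@card_le3 p c l); apply/subsetP=> z zS.
    have := cover z zS; rewrite in_cons => /orP[/eqP E|//].
    by rewrite inE E tS in zS.
  have [pS|pS] := boolP (p \in S); last by case: (fort3 p q l).
  apply: (@card_le3 t c l); apply/subsetP=> z zS.
  have := cover z zS; rewrite !inE => /or4P[->|/eqP E|->|->]; rewrite ?orbT //.
  by rewrite inE E pS in zS.
(* As a and b are twins, one of them is black and plays the role of q. *)
have [bS|bS] := boolP (b \in S); first exact: (bound a b).
have [aS|aS] := boolP (a \in S).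
  apply: (bound b a) => // [u|z]; last by rewrite !inE; do 4! case: (z == _).
  by rewrite adj_t !inE; do 3! case: (u == _).
case: (twins a b) => // u; rewrite adj_a adj_b !inE !negb_or.
by case/andP=> /negbTE-> /negbTE->.
Qed.
End TriangleStar.

(** * Unicyclic graphs without a run of four forces *)

Section Unicyclic.
Variable G : sgraph.
Hypothesis G_conn : connected G.
Hypothesis no_chain4 : forall s : seq (G * G), size s = 4 -> ~~ forcing_chain s.
Implicit Types (x y z v : G).

Definition on_all_cycles v :=
  forall d, 2 < size d -> cycle (@adj G) d -> uniq d -> v \in d.

(* Otherwise the path closes up to a cycle avoiding v. *)
Lemma path_ends_not_adj v x p : on_all_cycles v -> v \notin x :: p ->
  path (@adj G) x p -> uniq (x :: p) -> 1 < size p -> ~~ adj x (last x p).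
Proof.
move=> core_v /negP vp pp up sp; apply/negP=> xl; apply: vp; apply: core_v => //.
by rewrite /= rcons_path pp adj_sym.
Qed.

(** All six non-consecutive pairs are non-adjacent, since an edge would close a cycle avoiding v.
    Hence the path is induced, and forcing along it is a run of four forces. *)
Lemma no_path5 v x0 x1 x2 x3 x4 : on_all_cycles v ->
  v \notin [:: x0; x1; x2; x3; x4] ->
  uniq [:: x0; x1; x2; x3; x4] -> ~~ path (@adj G) x0 [:: x1; x2; x3; x4].
Proof.
move=> vc; rewrite /= !inE !negb_or => /and5P[v0 v1 v2 v3 v4].
case/and5P=> /and4P[n01 n02 n03 n04] /and3P[n12 n13 n14] /andP[n23 n24] n34 _.
apply/negP=> /and5P[e01 e12 e23 e34 _].
have nadj y p := @path_ends_not_adj v y p vc.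
have /negP[] := no_chain4 (erefl : size [:: (x0, x1); (x1, x2); (x2, x3); (x3, x4)] = 4).
have := nadj x0 [:: x1; x2]; have := nadj x0 [:: x1; x2; x3].
have := nadj x0 [:: x1; x2; x3; x4]; have := nadj x1 [:: x2; x3].
have := nadj x1 [:: x2; x3; x4]; have := nadj x2 [:: x3; x4].
rewrite /= !inE !negb_or !(v0, v1, v2, v3, v4) !(e01, e12, e23, e34).
rewrite !(n01, n02, n03, n04, n12, n13, n14, n23, n24, n34) /=.
by do 6! move=> /(_ isT isT isT isT) ->.
Qed.

(** Take an edge x y leaving the closed neighborhood of [s]. Its inner end x is not in [s], as
    otherwise y would belong to that neighborhood. *)
Lemma distance2_vertex (s : seq G) v z : v \in s -> z \notin s ->
  ~~ has (adj z) s ->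
  exists u x y, [/\ u \in s, x \notin s, y \notin s & adj u x && adj x y].
Proof.
move=> vs zs nz; pose S := [set x | (x \in s) || has (adj x) s].
have [||x xS [y yS xy]] := @connected_edge_boundary _ S v z G_conn.
- by rewrite inE vs.
- by rewrite inE negb_or zs.
move: xS yS; rewrite !inE negb_or => xS /andP[ys /hasPn ny].
have xs : x \notin s by apply/negP=> /ny; rewrite adj_sym xy.
move: xS; rewrite (negbTE xs) /= => /hasP[u us xu].
by exists u, x, y; split=> //; rewrite adj_sym xu xy.
Qed.

Ltac distinct := rewrite /= ?inE ?negb_or ?andbT;
  repeat (apply/andP; split);
  first [done | by rewrite eq_sym | by rewrite adj_sym].
Ltac split_hyps := repeat match goal with
  | H : is_true (_ && _) |- _ => case/andP: H; do 2 ?move=> ?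
  end.
(** [nonadj] records that the ends of a path avoiding v are not adjacent; [path5] closes a goal by
    exhibiting a five-vertex path avoiding v. *)
Ltac nonadj v x p H :=
  have H : ~~ adj x (last x p) by apply: (@path_ends_not_adj v); distinct.
Ltac path5 v x0 x1 x2 x3 x4 :=
  have /negP[] : ~~ path (@adj G) x0 [:: x1; x2; x3; x4];
  [by apply: (@no_path5 v); distinct | distinct].

(** * Exclusion of cycles of length four *)

Definition quad v0 v1 v2 v3 :=
  [/\ uniq [:: v0; v1; v2; v3],
      [&& adj v0 v1, adj v1 v2, adj v2 v3 & adj v3 v0]
    & forall v, v \in [:: v0; v1; v2; v3] -> on_all_cycles v].

Lemma quad_rot v0 v1 v2 v3 : quad v0 v1 v2 v3 -> quad v1 v2 v3 v0.
Proof.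
case=> u /and4P[? ? ? ?] core; split.
- by rewrite -[X in uniq X]/(rot 1 [:: v0; v1; v2; v3]) rot_uniq.
- by apply/and4P.
- by move=> v; rewrite -[X in v \in X]/(rot 1 [:: v0; v1; v2; v3]) mem_rot; apply: core.
Qed.

Lemma quad_rev v0 v1 v2 v3 : quad v0 v1 v2 v3 -> quad v3 v2 v1 v0.
Proof.
case=> u /and4P[? ? ? ?] core; split.
- by rewrite -[X in uniq X]/(rev [:: v0; v1; v2; v3]) rev_uniq.
- by distinct.
- by move=> v; rewrite -[X in v \in X]/(rev [:: v0; v1; v2; v3]) mem_rev; apply: core.
Qed.

Lemma quad_to v0 v1 v2 v3 v : quad v0 v1 v2 v3 -> v \in [:: v0; v1; v2; v3] ->
  exists w1 w2 w3, quad v w1 w2 w3 /\ [:: v; w1; w2; w3] =i [:: v0; v1; v2; v3].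
Proof.
move=> q; rewrite !inE; case/or4P=> /eqP ->.
- by exists v1, v2, v3.
- exists v2, v3, v0; split; first exact: quad_rot.
  by move=> x; rewrite !inE; do 4! case: (x == _).
- exists v3, v0, v1; split; first by do 2! apply: quad_rot.
  by move=> x; rewrite !inE; do 4! case: (x == _).
- exists v0, v1, v2; split; first by do 3! apply: quad_rot.
  by move=> x; rewrite !inE; do 4! case: (x == _).
Qed.

(** If y is attached at v0 or v1, there is an explicit run of four forces; at v2, the path x v0 v1
    v2 y avoids v3. The corner v3 is the mirror image of v1. *)
Lemma quad_attached v0 v1 v2 v3 x y : quad v0 v1 v2 v3 ->
  x \notin [:: v0; v1; v2; v3] -> y \notin [:: v0; v1; v2; v3] -> x != y ->
  adj x v0 -> ~~ has (adj y) [:: v0; v1; v2].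
Proof.
case=> u adjs core; rewrite /= !inE !negb_or => hx hy xy xv0.
have c1 : on_all_cycles v1 by apply: core; rewrite !inE eqxx ?orbT.
have c2 : on_all_cycles v2 by apply: core; rewrite !inE eqxx ?orbT.
have c3 : on_all_cycles v3 by apply: core; rewrite !inE eqxx ?orbT.
move: u; rewrite /= !inE !negb_or => u; split_hyps.
nonadj v2 x [:: v0; v1] xv1.
nonadj v3 x [:: v0; v1; v2] xv2.
nonadj v2 x [:: v0; v3] xv3.
nonadj v3 v0 [:: v1; v2] v0v2.
nonadj v2 v1 [:: v0; v3] v1v3.
rewrite andbT; apply/and3P; split; apply/negP=> yv.
- nonadj v2 x [:: v0; y] nxy.
  nonadj v2 y [:: v0; v1] yv1.
  nonadj v3 y [:: v0; v1; v2] yv2.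
  have /negP[] := no_chain4 (erefl : size [:: (x, v0); (v1, v2); (v2, v3); (v0, y)] = 4).
  by distinct.
- nonadj v3 y [:: v1; v2] yv2.
  nonadj v2 y [:: v1; v0; v3] yv3.
  have /negP[] := no_chain4 (erefl : size [:: (x, v0); (y, v1); (v0, v3); (v1, v2)] = 4).
  by distinct.
by path5 v3 x v0 v1 v2 y.
Qed.

Lemma no_quad v0 v1 v2 v3 : 5 < #|G| -> ~ quad v0 v1 v2 v3.
Proof.
move=> n6 q; pose s := [:: v0; v1; v2; v3].
have attached z : z \notin s -> has (adj z) s.
  (* Otherwise some y at distance 2 gives a path y x u w1 w2 avoiding w3. *)
  move=> zs; apply/negPn/negP=> nz.
  have [|u [x [y [us xs ys /andP[ux xy]]]]] := @distance2_vertex s v0 z _ zs nz.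
    exact: mem_head.
  have [w1 [w2 [w3 [[uq adjs core] sE]]]] := quad_to q us.
  have c3 : on_all_cycles w3 by apply: core; rewrite !inE eqxx ?orbT.
  move: xs ys uq; rewrite -2!sE /= !inE !negb_or => xs ys uq.
  have xy' : x != y by apply/eqP=> E; rewrite E adj_irr in xy.
  split_hyps; by path5 w3 y x u w1 w2.
have /card_gt1P[x [y [xs ys xy]]] : 1 < #|[pred z | z \notin s]|.
  by apply: leq_trans (card_notin s); rewrite leq_subRL // (leq_trans _ n6).
have /hasP[v vs xv] := attached x xs.
have [w1 [w2 [w3 [qw sE]]]] := quad_to q vs.
have xw : x \notin [:: v; w1; w2; w3] by rewrite sE.
have yw : y \notin [:: v; w1; w2; w3] by rewrite sE.
have /hasP[w] := attached y ys; rewrite -sE => ws yw'.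
have /= := quad_attached qw xw yw xy xv.
(* Reflection fixes v and exchanges w1 with w3, which rules out the last corner w3 for y. *)
have qw' : quad v w3 w2 w1 by do 3! apply: quad_rot; apply: quad_rev.
have eqs : [:: v; w3; w2; w1] =i [:: v; w1; w2; w3].
  by move=> z; rewrite !inE; do 4! case: (z == _).
have /= := quad_attached qw' _ _ xy xv; rewrite !eqs => /(_ xw yw).
by move: ws yw'; rewrite !inE => /or4P[] /eqP -> ->; rewrite ?orbT.
Qed.

(** * The case of a triangle *)

Definition triangle a b c :=
  [/\ uniq [:: a; b; c], [&& adj a b, adj b c & adj c a]
    & forall v, v \in [:: a; b; c] -> on_all_cycles v].

Lemma triangle_rot a b c : triangle a b c -> triangle b c a.
Proof.
case=> u /and3P[? ? ?] core; split.
- by rewrite -[X in uniq X]/(rot 1 [:: a; b; c]) rot_uniq.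
- by apply/and3P.
- by move=> v; rewrite -[X in v \in X]/(rot 1 [:: a; b; c]) mem_rot; apply: core.
Qed.

Lemma triangle_rev a b c : triangle a b c -> triangle c b a.
Proof.
case=> u /and3P[? ? ?] core; split.
- by rewrite -[X in uniq X]/(rev [:: a; b; c]) rev_uniq.
- by distinct.
- by move=> v; rewrite -[X in v \in X]/(rev [:: a; b; c]) mem_rev; apply: core.
Qed.

(** Excludes the net. With a, c, y, z white, x forces a and a forces c; then b and c have only y and
    z left to force. *)
Lemma triangle_not_three a b c x y z : triangle a b c ->
  x \notin [:: a; b; c] -> y \notin [:: a; b; c] -> z \notin [:: a; b; c] ->
  adj x a -> adj y b -> ~~ adj z c.
Proof.
case=> u adjs core; rewrite /= !inE !negb_or => hx hy hz xa yb; apply/negP=> zc.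
have ca : on_all_cycles a by apply: core; rewrite !inE eqxx ?orbT.
have cb : on_all_cycles b by apply: core; rewrite !inE eqxx ?orbT.
have cc : on_all_cycles c by apply: core; rewrite !inE eqxx ?orbT.
move: u; rewrite /= !inE !negb_or => u; split_hyps.
nonadj c x [:: a; b] xb.
nonadj b x [:: a; c] xc.
nonadj c y [:: b; a] ya.
nonadj a y [:: b; c] yc.
nonadj b z [:: c; a] za.
nonadj a z [:: c; b] zb.
have xy : x != y by apply/eqP=> E; rewrite E yb in xb.
have xz : x != z by apply/eqP=> E; rewrite E zc in xc.
have yz : y != z by apply/eqP=> E; rewrite E zc in yc.
nonadj c x [:: a; b; y] nxy.
nonadj b x [:: a; c; z] nxz.
have /negP[] := no_chain4 (erefl : size [:: (x, a); (a, c); (b, y); (c, z)] = 4).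
by distinct.
Qed.

(** With a, b, y, x' white, x forces a, c forces b, b forces y, and finally a forces x'. *)
Lemma triangle_not_two a b c x x' y : triangle a b c ->
  x \notin [:: a; b; c] -> x' \notin [:: a; b; c] -> y \notin [:: a; b; c] ->
  x != x' -> adj x a -> adj x' a -> ~~ adj y b.
Proof.
case=> u adjs core; rewrite /= !inE !negb_or => hx hx' hy xx' xa x'a; apply/negP=> yb.
have ca : on_all_cycles a by apply: core; rewrite !inE eqxx ?orbT.
have cb : on_all_cycles b by apply: core; rewrite !inE eqxx ?orbT.
have cc : on_all_cycles c by apply: core; rewrite !inE eqxx ?orbT.
move: u; rewrite /= !inE !negb_or => u; split_hyps.
nonadj c x [:: a; b] xb.
nonadj c x' [:: a; b] x'b.
nonadj b x' [:: a; c] x'c.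
nonadj a y [:: b; c] yc.
have xy : x != y by apply/eqP=> E; rewrite E yb in xb.
have x'y : x' != y by apply/eqP=> E; rewrite E yb in x'b.
nonadj c x [:: a; b; y] nxy.
nonadj c x [:: a; x'] nxx'.
have /negP[] := no_chain4 (erefl : size [:: (x, a); (c, b); (b, y); (a, x')] = 4).
by distinct.
Qed.

(** The path from y through x to a excludes further neighbors of each corner; then every remaining
    vertex must hang on x. *)
Lemma triangle_distance2 a b c x y : triangle a b c ->
  x \notin [:: a; b; c] -> y \notin [:: a; b; c] -> adj a x -> adj x y ->
  triangle_star a b c x.
Proof.
case=> u adjs core; rewrite /= !inE !negb_or => hx hy ax exy.
have ca : on_all_cycles a by apply: core; rewrite !inE eqxx ?orbT.
have cb : on_all_cycles b by apply: core; rewrite !inE eqxx ?orbT.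
have cc : on_all_cycles c by apply: core; rewrite !inE eqxx ?orbT.
move: u; rewrite /= !inE !negb_or => u; split_hyps.
have xy : x != y by apply/eqP=> E; rewrite E adj_irr in exy.
nonadj c x [:: a; b] xb.
nonadj b x [:: a; c] xc.
nonadj b y [:: x; a] ya.
nonadj c y [:: x; a; b] yb.
nonadj b y [:: x; a; c] yc.
(* The run is y -> x -> a, b -> c, a -> z. For b and c below, five-vertex paths suffice. *)
have nbhd_a z : z \notin [:: a; b; c; x] -> ~~ adj a z.
  rewrite !inE !negb_or => hz; apply/negP=> az; split_hyps.
  have yz : y != z by apply/eqP=> E; rewrite E adj_sym az in ya.
  nonadj b x [:: a; z] nxz.
  nonadj c b [:: a; z] nbz.
  nonadj b y [:: x; a; z] nyz.
  have /negP[] := no_chain4 (erefl : size [:: (y, x); (x, a); (b, c); (a, z)] = 4).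
  by distinct.
have nbhd_b z : z \notin [:: a; b; c; x] -> ~~ adj b z.
  rewrite !inE !negb_or => hz; apply/negP=> bz; split_hyps.
  have yz : y != z by apply/eqP=> E; rewrite E adj_sym bz in yb.
  by path5 c y x a b z.
have nbhd_c z : z \notin [:: a; b; c; x] -> ~~ adj c z.
  rewrite !inE !negb_or => hz; apply/negP=> cz; split_hyps.
  have yz : y != z by apply/eqP=> E; rewrite E adj_sym cz in yc.
  by path5 b y x a c z.
have nbhd_x z : z \notin [:: a; b; c; x] -> adj x z.
  move=> hz; apply/negPn/negP=> nxz.
  (* An edge p q leaving this set can only start at a neighbor p of x outside the four vertices;
     then q p x a b avoids c. *)
  pose S := [set w | (w \in [:: a; b; c; x]) || adj x w].
  have [||p pS [q qS pq]] := @connected_edge_boundary _ S a z G_conn.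
  - by rewrite !inE eqxx.
  - by rewrite inE negb_or hz.
  move: qS; rewrite inE negb_or => /andP[qs nxq].
  have [ps|ps] := boolP (p \in [:: a; b; c; x]).
    move: (nbhd_a q qs) (nbhd_b q qs) (nbhd_c q qs).
    by move: ps pq nxq; rewrite !inE => /or4P[] /eqP -> ->.
  move: pS; rewrite inE (negbTE ps) /= => xp.
  have npq : q != p by apply/eqP=> E; rewrite E adj_irr in pq.
  move: ps qs; rewrite !inE !negb_or => ps qs.
  split_hyps; by path5 c q p x a b.
apply: triangle_star_intro; first by distinct.
- by distinct.
- by move=> z hz; rewrite nbhd_x // nbhd_a // nbhd_b // nbhd_c.
move=> p q ps qs; have [->|pq] := eqVneq p q; first by rewrite adj_irr.
have := nbhd_x p ps; have := nbhd_x q qs.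
move: ps qs; rewrite !inE !negb_or => ps qs xp xq; split_hyps.
(* An edge p q would close a triangle with x that avoids a. *)
have /= -> // := @path_ends_not_adj a p [:: x; q] ca.
all: distinct.
Qed.

(** Two outside neighbors of a leave none for b or c, so every other vertex would be adjacent to a,
    isolating a in the complement. *)
Lemma triangle_attached_le1 a b c : 1 < #|G| -> connected (compl G) ->
  triangle a b c ->
  (forall z, z \notin [:: a; b; c] -> has (adj z) [:: a; b; c]) ->
  #|[pred z | (z \notin [:: a; b; c]) && adj z a]| <= 1.
Proof.
move=> n1 coG tri attached; rewrite leqNgt.
apply/negP=> /card_gt1P[x [x' [/andP[xs xa] /andP[x's x'a] xx']]].
have [y ya nay] := co_connected_non_neighbor a n1 coG.
have [u /and3P[ab bc ca] _] := tri.
have ys : y \notin [:: a; b; c].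
  rewrite !inE !negb_or ya /=; apply/andP; split; apply/eqP=> E.
    by rewrite E ab in nay.
  by rewrite E adj_sym ca in nay.
have tri' : triangle a c b by do 2!apply: triangle_rot; apply: triangle_rev.
have sE : [:: a; c; b] =i [:: a; b; c].
  by move=> z; rewrite !inE; do 3! case: (z == _).
have /= := attached y ys; rewrite orbF adj_sym (negbTE nay) /=.
rewrite (negbTE (triangle_not_two tri xs x's ys xx' xa x'a)) /=.
have := @triangle_not_two a c b x x' y tri'; rewrite !sE.
by move=> /(_ xs x's ys xx' xa x'a)/negbTE->.
Qed.

Lemma triangle_case a b c : 5 < #|G| -> connected (compl G) -> triangle a b c ->
  exists t a' b' c' : G, triangle_star t a' b' c'.
Proof.
move=> n6 coG tri; pose s := [:: a; b; c].
have n1 : 1 < #|G| by apply: leq_trans n6.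
have rotE p q r : [:: p; q; r] =i [:: q; r; p].
  by move=> z; rewrite !inE; do 3! case: (z == _).
have tri1 := triangle_rot tri; have tri2 := triangle_rot tri1.
have [/existsP[z /andP[zs nz]]|] := boolP [exists z, (z \notin s) && ~~ has (adj z) s].
  have [u [x [y [us xs ys /andP[ux xy]]]]] := distance2_vertex (mem_head a _) zs nz.
  move: us ux; rewrite !inE => /or3P[] /eqP -> ux.
  - by exists a, b, c, x; apply: triangle_distance2 ux xy.
  - by exists b, c, a, x; apply: triangle_distance2 tri1 _ _ ux xy; rewrite -rotE.
  - by exists c, a, b, x; apply: triangle_distance2 tri2 _ _ ux xy; rewrite -2!rotE.
rewrite negb_exists => /forallP attached'.
have attached z : z \notin s -> has (adj z) s.
  by move=> zs; have := attached' z; rewrite zs negbK.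
pose A v := [pred z | (z \notin s) && adj z v].
have Aa : #|A a| <= 1 by apply: triangle_attached_le1 attached.
have Ab : #|A b| <= 1.
  rewrite (_ : #|_| = #|[pred z | (z \notin [:: b; c; a]) && adj z b]|).
    apply: triangle_attached_le1 tri1 _ => // z; rewrite -rotE => /attached.
    by rewrite /= !orbF; case/or3P=> ->; rewrite ?orbT.
  by apply: eq_card => z; rewrite !inE; do 3! case: (z == _).
have Ac : #|A c| <= 1.
  rewrite (_ : #|_| = #|[pred z | (z \notin [:: c; a; b]) && adj z c]|).
    apply: triangle_attached_le1 tri2 _ => // z; rewrite -2!rotE => /attached.
    by rewrite /= !orbF; case/or3P=> ->; rewrite ?orbT.
  by apply: eq_card => z; rewrite !inE; do 3! case: (z == _).
(* At least three vertices lie outside the triangle, each attached to some corner; with at most one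
   per corner, every corner has one, which gives the net. *)
have ge3 : 3 <= #|A a| + #|A b| + #|A c|.
  have : 3 <= #|[pred z | z \notin s]|.
    by apply: leq_trans (card_notin s); rewrite leq_subRL // (leq_trans _ n6).
  move/leq_trans; apply; rewrite -(cardsE (A a)) -(cardsE (A b)) -(cardsE (A c)).
  apply: leq_trans (leq_add (leq_card_setU _ _).1 (leqnn _)).
  apply: leq_trans (leq_card_setU _ _).1.
  apply/subset_leq_card/subsetP=> z zs; have zs' : z \notin s by [].
  have inA v : adj z v -> z \in [set w in A v] by move=> zv; rewrite inE; apply/andP.
  rewrite !in_setU; have /= := attached z zs'; rewrite orbF.
  by case/or3P=> /inA ->; rewrite ?orbT.
have ne v : 0 < #|A v| -> exists2 x, x \notin s & adj x v.
  by case/card_gt0P=> x /andP[xs xv]; exists x.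
have [|x xs xa] := ne a.
  by rewrite lt0n; apply/eqP=> E; move: ge3; rewrite E leqNgt ltnS (leq_add Ab Ac).
have [|y ys yb] := ne b.
  by rewrite lt0n; apply/eqP=> E; move: ge3; rewrite E addn0 leqNgt ltnS (leq_add Aa Ac).
have [|z zs zc] := ne c.
  by rewrite lt0n; apply/eqP=> E; move: ge3; rewrite E addn0 leqNgt ltnS (leq_add Aa Ab).
by have := triangle_not_three tri xs ys zs xa yb; rewrite zc.
Qed.

(** * Exclusion of cycles of length at least five *)

(** On a cycle of length at least 6, five consecutive vertices form a path avoiding a sixth. For
    length 5, some x off the cycle is adjacent to a cycle vertex v, and x v w1 w2 w3 avoids w4. *)
Lemma no_long_cycle c : 5 < #|G| -> cycle (@adj G) c -> uniq c ->
  (forall v, v \in c -> on_all_cycles v) -> size c <= 4.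
Proof.
case: c => [|v0 [|v1 [|v2 [|v3 [|v4 [|v5 r]]]]]] // n6 cyc u core; last first.
  have core5 : on_all_cycles v5 by apply: core; rewrite !inE eqxx !orbT.
  move: cyc u; rewrite /= !inE !negb_or => cyc u; split_hyps.
  by path5 v5 v0 v1 v2 v3 v4.
set c := [:: v0; v1; v2; v3; v4] in cyc u core *.
have /card_gt0P[z zc] : 0 < #|[pred z | z \notin c]|.
  by apply: leq_trans (card_notin c); rewrite subn_gt0.
have [||v] := @connected_edge_boundary _ [set w in c] v0 z G_conn.
- by rewrite !inE eqxx.
- by rewrite inE.
rewrite inE => vc [x]; rewrite inE => xc vx.
have [i w def] := rot_to vc.
have sw : size (v :: w) = 5 by rewrite -def size_rot.
have uw : uniq (v :: w) by rewrite -def rot_uniq.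
have cw : cycle (@adj G) (v :: w) by rewrite -def rot_cycle.
have xw : x \notin v :: w by rewrite -def mem_rot.
have core_w y : y \in v :: w -> on_all_cycles y by rewrite -def mem_rot; apply: core.
case: w sw uw cw xw core_w {def} => [|w1 [|w2 [|w3 [|w4 [|]]]]] //= _ uw cw xw core_w.
have core4 : on_all_cycles w4 by apply: core_w; rewrite !inE eqxx !orbT.
move: uw xw; rewrite !inE !negb_or => uw xw; split_hyps.
by path5 w4 x v w1 w2 w3.
Qed.

End Unicyclic.

(** * The equivalence, by the length of the unique cycle *)

Theorem theorem5p2 (G : sgraph) (n : nat) (hn : #|G| = n) (n6 : 6 <= n)
    (G_unicyclic : unicyclic G) (coG_connected : connected (compl G)) :
  zero_forcing_number G = n - 3 <->
  exists (t : cycle_graph 3) (l : star (n - 2)),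
    leaf l /\ graph_iso G (vertex_sum t l).
Proof.
case: n n6 hn => [|[|[|[|[|[|m]]]]]] // _ hn.
have n6 : 5 < #|G| by rewrite hn.
split=> [Z|[t [l [leaf_l isoG]]]]; last first.
  (* With n = m + 6, the star has n - 2 = (m + 1) + 3 vertices, whence the argument [m.+1]. *)
  have [t' [a [b [c /(graph_iso_triangle_star isoG)]]]] :=
    @vertex_sum_triangle_star m.+1 t l leaf_l.
  case=> t1 [a1 [b1 [c1 starG]]].
  by rewrite (triangle_star_zero_forcing_number _ starG) hn.
(* A run of four forces would give Z(G) <= n - 4. *)
have no4 (s : seq (G * G)) : size s = 4 -> ~~ forcing_chain s.
  move=> s4; apply/negP=> /zero_forcing_number_chain.
  by rewrite Z hn s4 !subSS subn0 ltnn.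
have [t [a [b [c starG]]]] : exists t a b c : G, triangle_star t a b c.
  have [conG _] := G_unicyclic.
  have [c /andP[/andP[c2 cc] cu] c_min] := unicyclic_mem G_unicyclic.
  have core v : v \in c -> on_all_cycles v.
    by move=> vc d d2 cd du; apply: c_min d2 cd du v vc.
  have c4 := no_long_cycle conG no4 n6 cc cu core.
  case: c c2 c4 cc cu core {c_min} => [|v0 [|v1 [|v2 [|v3 [|]]]]] //= _ _ cc cu core.
    apply: (@triangle_case G conG no4 v0 v1 v2) => //; split=> //.
    by move: cc; rewrite andbT.
  have [] := @no_quad G conG no4 v0 v1 v2 v3 n6; split=> //.
  by move: cc; rewrite andbT.
have leaf0 : leaf (inr ord0 : star (m.+4.+2 - 2)).
  apply/cards1P; exists (inl ord0); apply/setP=> -[x|x]; rewrite !inE //.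
  by rewrite (ord1 x) eqxx.
exists (ord0 : cycle_graph 3), (inr ord0); split=> //.
have [t' [a' [b' [c' starH]]]] :=
  @vertex_sum_triangle_star m.+1 (ord0 : cycle_graph 3) _ leaf0.
apply: triangle_star_iso starG starH.
(* The vertex sum has 3 + (n - 3) vertices, the star losing its merged leaf. *)
rewrite hn card_sum card_sig card_ord.
have := cardC1 (inr ord0 : star (m.+4.+2 - 2)); rewrite card_sum !card_ord /= => E.
by apply: (congr1 (addn 3)); rewrite -[LHS]E.
Qed.
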